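(* Let $B(t,x;123,321)=\sum_{n=0}^{\infty}\sum_{\pi\in\mathfrak{S}_n(123,321)}t^{\mathrm{bdes}(\pi)}x^n$. Then $$B(t,x;123,321)=1+x+2x^{2}+(2+2t)x^{3}+(1+2t+t^{2})x^{4}.$$
   Context: $\mathfrak{S}_n$ is the set of permutations $\pi=\pi_1\pi_2\cdots\pi_n$ of $[n]=\{1,\dots,n\}$ in one-line notation ($\mathfrak{S}_0$ consists of the empty permutation). $\mathfrak{S}_n(123,321)$ is the set of $\pi\in\mathfrak{S}_n$ having no length-three subsequence with the same relative order as $123$ or as $321$. An index $k\in[n-1]$ is a big descent of $\pi\in\mathfrak{S}_n$ if $\pi_k>\pi_{k+1}+1$; $\mathrm{bdes}(\pi)$ is the number of big descents of $\pi$. *)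

(* Defs.v *)
From HB Require Import structures.
From mathcomp Require Import all_boot all_order all_fingroup all_algebra.

Set Implicit Arguments.
Unset Strict Implicit.
Unset Printing Implicit Defensive.

Import GRing.Theory.

(* MathComp's 'S_n permutes {0, ..., n-1}; the shift gives letters in [n]. *)
Definition one_line (n : nat) (s : 'S_n) : seq nat :=
  [seq (s i).+1 | i <- enum 'I_n].

Definition same_order (u v : seq nat) : bool :=
  (size u == size v) &&
  [forall i : 'I_(size u), forall j : 'I_(size u),
     (nth 0 u i < nth 0 u j) == (nth 0 v i < nth 0 v j)].

(* The subsequences of w are the mask m w, with m a bit mask of length size w. *)
Definition contains (w p : seq nat) : bool :=
  [exists m : (size w).-tuple bool, same_order (mask m w) p].

Definition avoids (w : seq nat) (ps : seq (seq nat)) : bool :=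
  all (fun p => ~~ contains w p) ps.

(* Positions k are counted from 1, whereas nth counts from 0. *)
Definition big_descent (w : seq nat) (k : nat) : bool :=
  nth 0 w k + 1 < nth 0 w k.-1.

Definition bdes (w : seq nat) : nat :=
  count (big_descent w) (iota 1 (size w).-1).

Local Open Scope ring_scope.

(* A formal power series is its sequence of coefficients; equality of series
   is coefficientwise (=1). *)
Definition fps (R : Type) : Type := nat -> R.

Definition fps_of_poly (R : nzRingType) (p : {poly R}) : fps R := fun n => p`_n.

(* A series in x whose coefficients are polynomials in t := 'X : {poly int}. *)
Definition bdes_series (ps : seq (seq nat)) : fps {poly int} :=
  fun n => \sum_(s : 'S_n | avoids (one_line s) ps) 'X^(bdes (one_line s)).

(* Main.v *)
(* By Erdős–Szekeres, a word of at least five distinct letters has a monotone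
   subsequence of length three, so only the coefficients with n <= 4 survive;
   these are enumerated over the permutations of [1; ...; n] as words. *)
Require Import Defs.
From mathcomp Require Import all_boot all_order all_fingroup all_algebra.
From mathcomp Require Import zify ring.

Set Implicit Arguments.
Unset Strict Implicit.
Unset Printing Implicit Defensive.

Import GRing.Theory.

Lemma one_line_uniq (n : nat) (s : 'S_n) : uniq (one_line s).
Proof.
rewrite map_inj_uniq ?enum_uniq // => i j [] /val_inj.
exact: perm_inj.
Qed.

Lemma size_one_line (n : nat) (s : 'S_n) : size (one_line s) = n.
Proof. by rewrite size_map size_enum_ord. Qed.

Lemma one_line_inj (n : nat) : injective (@one_line n).
Proof.
move=> s1 s2 /eq_in_map eq12; apply/permP => i.
by apply: val_inj; apply: succn_inj; apply: eq12; rewrite mem_enum.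
Qed.

(** The n letters are distinct and lie in [n], so by counting they exhaust it. *)
Lemma perm_one_line (n : nat) (s : 'S_n) : perm_eq (one_line s) (iota 1 n).
Proof.
have sub : {subset one_line s <= iota 1 n}.
  by move=> _ /mapP[i _ ->]; rewrite mem_iota add1n; exact: ltn_ord (s i).
have [|_ eqi] := uniq_min_size (one_line_uniq s) sub.
  by rewrite size_iota size_one_line.
exact: uniq_perm (one_line_uniq s) (iota_uniq 1 n) eqi.
Qed.

(** Distinct permutations give distinct words, and both lists have n! entries, so inclusion
    suffices. This moves sums over ['S_n] to a list that computes. *)
Lemma perm_map_one_line (n : nat) :
  perm_eq [seq one_line s | s : 'S_n] (permutations (iota 1 n)).
Proof.
have uniqL : uniq [seq one_line s | s : 'S_n].
  by rewrite map_inj_uniq ?enum_uniq //; exact: one_line_inj.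
have sub : {subset [seq one_line s | s : 'S_n] <= permutations (iota 1 n)}.
  by move=> _ /mapP[s _ ->]; rewrite mem_permutations perm_one_line.
have [|_ eqi] := uniq_min_size uniqL sub.
  rewrite size_permutations ?iota_uniq // size_iota size_map -cardE.
  by rewrite card_Sn.
exact: uniq_perm uniqL (permutations_uniq _) eqi.
Qed.

Lemma containsP (w p : seq nat) :
  reflect (exists2 u, subseq u w & same_order u p) (contains w p).
Proof.
apply: (iffP existsP) => [[m sm] | [u /subseqP[m szm ->] su]].
  by exists (mask m w); first exact: mask_subseq.
by exists (Tuple (introT eqP szm)).
Qed.

(** One entry per bit mask, hence possibly with repetitions; only membership matters. *)
Fixpoint subseqs (T : Type) (s : seq T) : seq (seq T) :=
  if s is x :: s' then map (cons x) (subseqs s') ++ subseqs s' else [:: [::]].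

Lemma mem_subseqs (T : eqType) (u s : seq T) : (u \in subseqs s) = subseq u s.
Proof.
elim: s u => [|x s IHs] u; first by rewrite mem_seq1 subseq0.
rewrite mem_cat IHs; apply/orP/idP => [[/mapP[v]|]|].
- by rewrite IHs => vs ->; rewrite /= eqxx.
- by move/subseq_trans; apply; exact: subseq_cons.
case: u => [_|y u /=]; first by right; exact: sub0seq.
by case: eqP => [->|_] us; [left; rewrite map_f // IHs | right].
Qed.

(* [contains] and [same_order] quantify over finite types, whose enumerations
   do not reduce; the list versions below do. *)
Definition same_order_list (u v : seq nat) : bool :=
  (size u == size v) &&
  all (fun i => all (fun j =>
     (nth 0 u i < nth 0 u j) == (nth 0 v i < nth 0 v j)) (iota 0 (size u)))
   (iota 0 (size u)).

Lemma same_order_listE : same_order =2 same_order_list.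
Proof.
move=> u v; congr (_ && _).
apply/forallP/allP => [H i | H i].
  rewrite mem_iota => /= ltiu; apply/allP=> j; rewrite mem_iota => /= ltju.
  exact: (forallP (H (Ordinal ltiu)) (Ordinal ltju)).
apply/forallP => j; have /H/allP-> // : val i \in iota 0 (size u).
  by rewrite mem_iota ltn_ord.
by rewrite mem_iota ltn_ord.
Qed.

Definition avoids_list (w : seq nat) (ps : seq (seq nat)) : bool :=
  all (fun p => ~~ has (same_order_list^~ p) (subseqs w)) ps.

Lemma avoids_listE : avoids =2 avoids_list.
Proof.
move=> w ps; apply: eq_all => p; congr (~~ _).
apply/containsP/hasP => -[u]; rewrite ?mem_subseqs => uw up; exists u => //.
- by rewrite mem_subseqs.
- by rewrite -same_order_listE.
- by rewrite same_order_listE.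
Qed.

Lemma contains123 (w : seq nat) (a b c : nat) :
  subseq [:: a; b; c] w -> a < b < c -> contains w [:: 1; 2; 3].
Proof.
move=> sw abc; apply/containsP; exists [:: a; b; c] => //.
rewrite same_order_listE /same_order_list /=.
lia.
Qed.

Lemma contains321 (w : seq nat) (a b c : nat) :
  subseq [:: a; b; c] w -> c < b < a -> contains w [:: 3; 2; 1].
Proof.
move=> sw abc; apply/containsP; exists [:: a; b; c] => //.
rewrite same_order_listE /same_order_list /=.
lia.
Qed.

Lemma erdos_szekeres5 (w : seq nat) :
  uniq w -> 4 < size w -> ~~ avoids w [:: [:: 1; 2; 3]; [:: 3; 2; 1]].
Proof.
case: w => [|a [|b [|c [|d [|e w]]]]] // /[swap] _.
set W := [:: a, b, c, d, e & w] => uniqW.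
have {uniqW} : uniq [:: a; b; c; d; e].
  by move: uniqW; rewrite -[W]/([:: a; b; c; d; e] ++ w) cat_uniq => /andP[].
rewrite /= !inE !negb_or => uniq5.
apply/negP => /and3P[/negP av123 /negP av321 _].
(* Masks on the five-letter prefix name the triples to test: below, abc, bcd, cde, abd and bde in
   turn. *)
have sub m : subseq (mask m [:: a; b; c; d; e]) W.
  apply: subseq_trans (mask_subseq _ _) _.
  by rewrite -[W]/([:: a; b; c; d; e] ++ w) prefix_subseq.
have mono x y z : subseq [:: x; y; z] W -> ~ (x < y < z) /\ ~ (z < y < x).
  by move=> sw; split=> [/(contains123 sw)|/(contains321 sw)].
(* If a < b, avoidance forces a < b > c < d > e, and then neither b < d
   (by a < b < d) nor d < b (by b > d > e) is possible; dually if b < a. *)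
have := mono _ _ _ (sub [:: true; true; true; false; false]).
have := mono _ _ _ (sub [:: false; true; true; true; false]).
have := mono _ _ _ (sub [:: false; false; true; true; true]).
have := mono _ _ _ (sub [:: true; true; false; true; false]).
have := mono _ _ _ (sub [:: false; true; false; true; true]).
clear - uniq5.
lia.
Qed.

Local Open Scope ring_scope.

(** Collecting the exponents in a list of naturals lets them be evaluated without computing in a
    polynomial ring. *)
Lemma bdes_seriesE (ps : seq (seq nat)) (n : nat) :
  bdes_series ps n =
  \sum_(k <- [seq bdes w | w <- permutations (iota 1 n) & avoids_list w ps])
     'X^k.
Proof.
rewrite big_map big_filter -(perm_big _ (perm_map_one_line n)) /=.
rewrite big_map big_enum_cond.
by apply: eq_bigl => s; rewrite avoids_listE.
Qed.

Theorem proposition3p15 :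
  let x : {poly {poly int}} := 'X in
  let t : {poly {poly int}} := ('X : {poly int})%:P in
  bdes_series [:: [:: 1; 2; 3]; [:: 3; 2; 1]]%N =1
  fps_of_poly (1 + x + 2%:R * x ^+ 2 + (2%:R + 2%:R * t) * x ^+ 3
               + (1 + 2%:R * t + t ^+ 2) * x ^+ 4).
Proof.
move=> x t n; rewrite /fps_of_poly.
pose T : {poly int} := 'X.
set p := (X in polyseq X).
have -> : p = Poly [:: 1; 1; 2%:R; 2%:R + 2%:R * T; 1 + 2%:R * T + T ^+ 2].
  (* [cons_poly_def] unfolds the coefficient list into Horner form in [x]; the morphism rules then
     push the constant embedding down to [t]. *)
  rewrite /= !cons_poly_def /p -/x !(rmorphD, rmorphM, rmorphXn) /=.
  rewrite !(rmorph1, rmorph_nat, polyC0) -/t; ring.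
rewrite coef_Poly; case: (ltnP n 5) => [lt5|le5]; last first.
  (* Beyond the five listed coefficients the right side is the default 0, and on the left no
     permutation avoids both patterns. *)
  rewrite nth_default // /bdes_series big1 // => s.
  by rewrite (negPf (erdos_szekeres5 (one_line_uniq s) _)) ?size_one_line.
rewrite bdes_seriesE; set L := (X in \sum_(k <- X) _).
(* Row n holds the [bdes] values of the avoiders in the order of [permutations]. For n = 3 these are
   132, 213, 231, 312; for n = 4 they are 2143, 2413, 3142, 3412, up to order. *)
have -> : L = nth [::] [:: [:: 0]; [:: 0]; [:: 0; 0];
    [:: 0; 1; 0; 1]; [:: 1; 0; 1; 2]]%N n.
  by rewrite {}/L; move: n lt5; do 5?[case=> [_|]] => //; vm_compute.
by move: n lt5 {L}; do 5?[case=> [_|]] => //=;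
  rewrite !(big_cons, big_nil) -/T; ring.
Qed.
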